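(* Let $\mathfrak{m}\subset\mathfrak{n}$ be nilpotent $\mathbb{F}_q$-algebras, and let $\mathfrak{m}^\perp=\{\gamma\in\mathfrak{n}^*:\ker\gamma\supset\mathfrak{m}\}$. Then the following are equivalent: (1) $U_\mathfrak{m}$ is supernormal in $U_\mathfrak{n}$. (2) $U_\mathfrak{m}$ is a normal subgroup of $U_\mathfrak{n}$ and $gX\in\mathfrak{m}$ for all $g\in U_\mathfrak{n}$ and $X\in\mathfrak{m}$. (3) $\mathfrak{m}$ is a two-sided ideal in $\mathfrak{n}$. (4) $U_\mathfrak{m}\gamma U_\mathfrak{m}=\{\gamma\}$ for all $\gamma\in\mathfrak{m}^\perp$. (5) $g\gamma h\in\mathfrak{m}^\perp$ for all $g,h\in U_\mathfrak{n}$ and $\gamma\in\mathfrak{m}^\perp$.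
   Context: $\mathbb{F}_q$ is a finite field; all algebras are finite-dimensional associative $\mathbb{F}_q$-algebras, and $\mathfrak{m}\subset\mathfrak{n}$ means that $\mathfrak{m}$ is a subalgebra of $\mathfrak{n}$. For a nilpotent $\mathbb{F}_q$-algebra $\mathfrak{n}$, the algebra group is $U_\mathfrak{n}=\{1+X:X\in\mathfrak{n}\}$ with multiplication $(1+X)(1+Y)=1+X+Y+XY$. It acts on $\mathfrak{n}$ on the left and right by $(1+X)Y=Y+XY$ and $Y(1+X)=Y+YX$, and on the dual space $\mathfrak{n}^*$ of $\mathbb{F}_q$-linear maps $\mathfrak{n}\to\mathbb{F}_q$ by $g\lambda(X)=\lambda(g^{-1}X)$ and $\lambda g(X)=\lambda(Xg^{-1})$; the left and right actions commute. The superclass of $U_\mathfrak{n}$ containing $g$ is $\{1+x(g-1)y:x,y\in U_\mathfrak{n}\}$. A subgroup of $U_\mathfrak{n}$ is supernormal if it is a union of superclasses of $U_\mathfrak{n}$. *)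

(* Defs.v *)
From HB Require Import structures.
From mathcomp Require Import all_boot all_fingroup all_algebra all_field.

Set Implicit Arguments.
Unset Strict Implicit.
Unset Printing Implicit Defensive.

Import GRing.Theory.
Local Open Scope ring_scope.

(* MathComp algebras are unital, so nilpotent algebras need their own
   structure: a finite-dimensional vector space with an associative bilinear
   product. *)
HB.mixin Record Vector_isAssocAlgebra (F : finFieldType) V of Vector F V := {
  amul : V -> V -> V;
  amulA : associative amul;
  amul_linearl : forall Y : V, linear (amul^~ Y);
  amul_linearr : forall X : V, linear (amul X)
}.

#[short(type="assocAlgType")]
HB.structure Definition AssocAlgebra (F : finFieldType) :=
  { V of Vector F V & Vector_isAssocAlgebra F V }.

Notation "X ** Y" := (amul X Y) (at level 40, left associativity).

(* Some power of the algebra is zero: all products of k + 1 elements vanish. *)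
HB.mixin Record AssocAlgebra_isNilpotent (F : finFieldType) V
    of AssocAlgebra F V := {
  amul_nilpotent : exists k : nat, forall (X : V) (s : seq V),
    size s = k -> foldl amul X s = 0
}.

#[short(type="nilAlgType")]
HB.structure Definition NilAlgebra (F : finFieldType) :=
  { V of AssocAlgebra F V & AssocAlgebra_isNilpotent F V }.

Section AssocTheory.
Variables (F : finFieldType) (n : assocAlgType F).
Implicit Types X Y Z : n.

Lemma amulDl X Y Z : (X + Y) ** Z = X ** Z + Y ** Z.
Proof. by have := amul_linearl Z 1 X Y; rewrite !scale1r. Qed.

Lemma amulDr X Y Z : X ** (Y + Z) = X ** Y + X ** Z.
Proof. by have := amul_linearr X 1 Y Z; rewrite !scale1r. Qed.

Lemma amul0l Y : 0 ** Y = 0.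
Proof. by apply: (addrI (0 ** Y)); rewrite -amulDl !addr0. Qed.

Lemma amul0r X : X ** 0 = 0.
Proof. by apply: (addrI (X ** 0)); rewrite -amulDr !addr0. Qed.

Lemma amulZl a X Y : (a *: X) ** Y = a *: (X ** Y).
Proof. by have := amul_linearl Y a X 0; rewrite !addr0 amul0l addr0. Qed.

Lemma amulZr a X Y : X ** (a *: Y) = a *: (X ** Y).
Proof. by have := amul_linearr X a Y 0; rewrite !addr0 amul0r addr0. Qed.

Lemma amulNl X Y : (- X) ** Y = - (X ** Y).
Proof. by rewrite -scaleN1r amulZl scaleN1r. Qed.

Record subalg := Subalg {
  subalg_vspace :> {vspace n};
  subalgM : forall X Y, X \in subalg_vspace -> Y \in subalg_vspace ->
    X ** Y \in subalg_vspace
}.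

Definition two_sided_ideal (m : {vspace n}) :=
  forall X Y, Y \in m -> X ** Y \in m /\ Y ** X \in m.

End AssocTheory.

(* OnePlus X stands for the formal element 1 + X, and sub1 g for g - 1. *)
Record algGroup (F : finFieldType) (n : nilAlgType F) : predArgType :=
  OnePlus { sub1 : n }.
Arguments algGroup {F} n.

Section AlgGroup.
Variables (F : finFieldType) (n : nilAlgType F).
Implicit Types (X Y : n) (g h : algGroup n).

Fact sub1K : cancel (fun g => sub1 g : finvect_type n) (@OnePlus F n).
Proof. by case. Qed.

HB.instance Definition _ := Finite.copy (algGroup n) (can_type sub1K).

Definition algGroup_mul g h : algGroup n :=
  OnePlus (sub1 g + sub1 h + sub1 g ** sub1 h).
Definition algGroup_one : algGroup n := OnePlus 0.
Definition algGroup_inv g : algGroup n :=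
  odflt algGroup_one [pick h | algGroup_mul h g == algGroup_one].

Fact algGroup_mulA : associative algGroup_mul.
Proof.
move=> [X] [Y] [Z]; congr OnePlus => /=.
rewrite !(amulDl, amulDr) amulA -!addrA; do 2!congr (_ + _).
by rewrite (addrCA (Y ** Z)) (addrCA Z) (addrCA (Y ** Z)).
Qed.

Fact algGroup_mul1 : left_id algGroup_one algGroup_mul.
Proof. by case=> X; congr OnePlus => /=; rewrite add0r amul0l addr0. Qed.

Fact algGroup_mulV : left_inverse algGroup_one algGroup_inv algGroup_mul.
Proof.
case=> X; rewrite /algGroup_inv; case: pickP => [h /eqP //| no_inv].
pose step Y := - X - Y ** X.
have stepE i Y Z : iter i step Y - iter i step Z =
    foldl amul ((-1) ^+ i *: (Y - Z)) (nseq i X).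
  elim: i Y Z => [|i IHi] Y Z; first by rewrite /= expr0 scale1r.
  rewrite !iterSr {}IHi /= /step opprD addrACA subrr add0r opprK.
  congr foldl; rewrite exprSr -scalerA scaleN1r opprB amulZl amulDl amulNl.
  by rewrite [in RHS]addrC.
have [k nil_k] := @amul_nilpotent F n.
have /eqP := stepE k (step 0) 0; rewrite nil_k ?size_nseq // -iterSr iterS.
rewrite subr_eq0 => /eqP fixY.
case/negP: (no_inv (OnePlus (iter k step 0))); apply/eqP; congr OnePlus => /=.
by rewrite -{1}fixY /step addrAC subrK addrC subrr.
Qed.

HB.instance Definition _ := Finite_isGroup.Build (algGroup n)
  algGroup_mulA algGroup_mul1 algGroup_mulV.

(* lact g Y = g Y and ract g Y = Y g *)
Definition lact g Y : n := Y + sub1 g ** Y.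
Definition ract g Y : n := Y + Y ** sub1 g.

Fact lact_linear g : linear (lact g).
Proof. by move=> a Y Z; rewrite /lact amulDr amulZr scalerDr addrACA. Qed.
HB.instance Definition _ g :=
  GRing.isLinear.Build F n n *:%R (lact g) (lact_linear g).

Fact ract_linear g : linear (ract g).
Proof. by move=> a Y Z; rewrite /ract amulDl amulZl scalerDr addrACA. Qed.
HB.instance Definition _ g :=
  GRing.isLinear.Build F n n *:%R (ract g) (ract_linear g).

Definition superclass g : {set algGroup n} :=
  [set OnePlus (ract y (lact x (sub1 g))) | x : algGroup n, y : algGroup n].

Definition supernormal (H : {group algGroup n}) :=
  exists A : {set algGroup n}, H :=: \bigcup_(g in A) superclass g.

Definition subalg_group (m : subalg n) : {set algGroup n} :=
  [set g | sub1 g \in m].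

Fact subalg_group_set m : group_set (subalg_group m).
Proof.
apply/group_setP; split=> [|g h]; rewrite !inE ?mem0v // => gm hm.
by rewrite /= !memvD ?subalgM.
Qed.
Canonical subalg_group_group m := Group (subalg_group_set m).

Definition dual : predArgType := finvect_type 'Hom(n, F^o).
HB.instance Definition _ := Finite.on dual.
Implicit Type gamma : dual.

(* dlact g gamma = g gamma and dract g gamma = gamma g *)
Definition dlact g gamma : dual :=
  linfun ((gamma : 'Hom(n, F^o)) \o lact g^-1%g).
Definition dract g gamma : dual :=
  linfun ((gamma : 'Hom(n, F^o)) \o ract g^-1%g).

Lemma dlactE g gamma X :
  (dlact g gamma : 'Hom(n, F^o)) X = (gamma : 'Hom(n, F^o)) (lact g^-1%g X).
Proof. by rewrite lfunE. Qed.

Lemma dractE g gamma X :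
  (dract g gamma : 'Hom(n, F^o)) X = (gamma : 'Hom(n, F^o)) (ract g^-1%g X).
Proof. by rewrite lfunE. Qed.

Lemma lractC g h X : lact g (ract h X) = ract h (lact g X).
Proof. by rewrite /lact /ract amulDr amulDl amulA addrACA. Qed.

Lemma dlractC g h gamma : dlact g (dract h gamma) = dract h (dlact g gamma).
Proof. by apply/lfunP=> X; rewrite dlactE !dractE dlactE lractC. Qed.

Definition perp (m : {vspace n}) : {set dual} :=
  [set gamma : dual | (m <= lker (gamma : 'Hom(n, F^o)))%VS].

End AlgGroup.

Arguments dual {F} n.

(* Main.v *)
Require Import Defs.
From mathcomp Require Import all_boot all_fingroup all_algebra all_field.
Import Defs.

(** All five conditions express one property of m: stability under the
    two-sided action X |-> g X h of U_n.  Since (1 + Y) X = X + Y X and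
    X (1 + Y) = X + X Y, stability says exactly that m is an ideal
    ([two_sided_idealE]).

    On the group side, the superclass of 1 + X is 1 + U_n X U_n, and a union
    of superclasses contains the superclass of each of its elements
    ([supernormal_superclass]), so supernormality of U_m is stability of m.
    The superclass of 1 + X contains the conjugates of 1 + X and all the
    1 + g X, which gives normality and left stability; conversely these two
    recover right stability, because X h = h (h^-1 X h).

    On the dual side, m is the common kernel of the functionals in its
    annihilator ([perp_separates]), so an assertion about all these functionals
    becomes an assertion about m.  Invariance of the annihilator under U_n is
    thus stability of m.  That U_m fixes every functional in the annihilator
    means that g X h - X lies in m for all X in n and g, h in U_m; taking g or
    h to be 1 puts X Y and Y X in m for X in n and Y in m, so m is an ideal.
    Conversely, when m is an ideal, g X h - X is a sum of products with a
    factor in m. *)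

Set Implicit Arguments.
Unset Strict Implicit.
Unset Printing Implicit Defensive.

Section Supernormal.
Import GRing.Theory.
Local Open Scope ring_scope.

Variables (F : finFieldType) (n : nilAlgType F).
Implicit Types (X Y : n) (g h : algGroup n) (gamma : dual n).

(** * The two actions on the algebra *)

Lemma lact1 X : lact 1%g X = X.
Proof. by rewrite /lact /= amul0l addr0. Qed.

Lemma ract1 X : ract 1%g X = X.
Proof. by rewrite /ract /= amul0r addr0. Qed.

Lemma lactM g h X : lact (g * h)%g X = lact g (lact h X).
Proof.
rewrite /lact /= !(amulDl, amulDr) -amulA -!addrA; congr (_ + _).
by rewrite addrCA.
Qed.

Lemma ractM g h X : ract (g * h)%g X = ract h (ract g X).
Proof. by rewrite /ract /= !(amulDl, amulDr) amulA -!addrA. Qed.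

Lemma sub1M g h : sub1 (g * h)%g = sub1 g + lact g (sub1 h).
Proof. by rewrite /lact addrA. Qed.

(** (1 + X)^h = h^-1 h + h^-1 X h, where the first term is 1. *)
Lemma sub1_conjg g h : sub1 (g ^ h)%g = lact h^-1%g (ract h (sub1 g)).
Proof.
have gh : sub1 (g * h)%g = sub1 h + ract h (sub1 g).
  by rewrite /ract addrA [sub1 h + _]addrC.
by rewrite conjgE sub1M gh linearD addrA -sub1M mulVg add0r.
Qed.

(** Acting on one side only, by 1 + X on Y, changes Y by the product X Y or
    Y X, so membership of the result in m is membership of that product. *)
Lemma two_sided_idealE (m : {vspace n}) :
  two_sided_ideal m <->
  (forall g h X, X \in m -> ract h (lact g X) \in m).
Proof.
split=> [idm g h X mX | stab X Y mY].
  have mgX : lact g X \in m by rewrite memvD //; case: (idm (sub1 g) X mX).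
  by rewrite memvD //; case: (idm (sub1 h) _ mgX).
split.
  by have := stab (OnePlus X) 1%g Y mY; rewrite ract1 rpredDl.
by have := stab 1%g (OnePlus X) Y mY; rewrite lact1 rpredDl.
Qed.

(** * Annihilators *)

Lemma perpP (m : {vspace n}) gamma :
  reflect (forall X, X \in m -> (gamma : 'Hom(n, F^o)) X = 0)
          (gamma \in perp m).
Proof.
rewrite inE; apply: (iffP subvP) => gm X /gm; first by rewrite memv_ker => /eqP.
by move=> gX; rewrite memv_ker gX.
Qed.

(** If X is not in m, its component along a complement of m is nonzero, and
    some coordinate of that component is a functional that kills m but
    not X. *)
Lemma perp_separates (m : {vspace n}) X :
  (forall gamma, gamma \in perp m -> (gamma : 'Hom(n, F^o)) X = 0) -> X \in m.
Proof.
move=> perpX.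
suff -> : X = projv m X by apply: memv_proj.
apply/eqP; rewrite -subr_eq0; apply/eqP.
rewrite (coord_vbasis (memvf (X - projv m X))) big1 // => i _.
pose f : 'Hom(n, F^o) :=
  (linfun (coord (vbasis {:n}) i : n -> F^o) \o (\1 - projv m))%VF.
have fE Y : f Y = coord (vbasis {:n}) i (Y - projv m Y).
  by rewrite /f comp_lfunE lfunE /= !lfun_simp.
have perp_f : (f : dual n) \in perp m.
  by apply/perpP=> Y mY; rewrite fE projv_id // subrr linear0.
by have := perpX f perp_f; rewrite fE => ->; rewrite scale0r.
Qed.

(** * Superclasses *)

Lemma mem_superclass g x y :
  OnePlus (ract y (lact x (sub1 g))) \in superclass g.
Proof. exact: imset2_f. Qed.

Lemma superclass_refl g : g \in superclass g.
Proof. by have := mem_superclass g 1%g 1%g; rewrite lact1 ract1; case: g. Qed.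

Lemma superclass_stable (m : subalg n) g :
  (forall x y X, X \in m -> ract y (lact x X) \in m) ->
  g \in subalg_group m -> superclass g \subset subalg_group m.
Proof.
move=> stab; rewrite inE => mg.
by apply/subsetP=> _ /imset2P[x y _ _ ->]; rewrite inE /= stab.
Qed.

(** Superclasses are the orbits of g - 1 under the two-sided action, so a
    union of superclasses contains the orbit of each of its points. *)
Lemma supernormal_superclass (H : {group algGroup n}) :
  supernormal H <-> (forall g, g \in H -> superclass g \subset H).
Proof.
split=> [[A defH] g | sHH].
  (* x' (x (a - 1) y) y' = (x' x) (a - 1) (y y') *)
  rewrite defH => /bigcupP[a Aa /imset2P[x y _ _ ->]].
  apply/subsetP=> _ /imset2P[x' y' _ _ ->] /=; apply/bigcupP; exists a => //.
  by rewrite lractC -lactM -ractM mem_superclass.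
exists H; apply/setP=> g; apply/idP/bigcupP=> [Hg | [h /sHH/subsetP]].
  by exists g; rewrite ?superclass_refl.
exact.
Qed.

(** * The five conditions *)

Lemma supernormal_normal_stable (m : subalg n) :
  supernormal (subalg_group_group m) ->
  (subalg_group m <| [set: algGroup n])%g /\
    (forall g X, X \in m -> lact g X \in m).
Proof.
move/supernormal_superclass=> sm.
have stab g h X : X \in m -> ract h (lact g X) \in m.
  move=> mX; have /subsetP sX : superclass (OnePlus X) \subset subalg_group m.
    by apply: sm; rewrite inE.
  by have := sX _ (mem_superclass (OnePlus X) g h); rewrite inE.
split=> [|g X mX]; last by rewrite -[lact g X]ract1 stab.
rewrite /normal subsetT; apply/subsetP=> h _; rewrite inE.
apply/subsetP=> _ /imsetP[g mg ->].
by rewrite inE sub1_conjg lractC stab //; rewrite inE in mg.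
Qed.

(** Normality says that h^-1 X h stays in m; multiplying it by h on the left
    turns this into right stability. *)
Lemma normal_stable_ideal (m : subalg n) :
  (subalg_group m <| [set: algGroup n])%g ->
  (forall g X, X \in m -> lact g X \in m) ->
  two_sided_ideal m.
Proof.
move=> /andP[_ /subsetP norm_m] stab; apply/two_sided_idealE=> g h X mX.
rewrite -lractC; apply: (stab _).
rewrite -[ract h X]lact1 -(mulgV h) lactM -[X]/(sub1 (OnePlus X)) -sub1_conjg.
apply: stab; have /normP nh := norm_m h (in_setT h).
have: (OnePlus X ^ h)%g \in (subalg_group m :^ h)%g by rewrite memJ_conjg inE.
by rewrite nh inE.
Qed.

Lemma dactE g h gamma X :
  (dlact g (dract h gamma) : 'Hom(n, F^o)) X =
  (gamma : 'Hom(n, F^o)) (ract h^-1%g (lact g^-1%g X)).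
Proof. by rewrite dlactE dractE. Qed.

(** For g, h in U_m, g^-1 X h^-1 differs from X by products with a factor in
    m, which gamma kills. *)
Lemma ideal_fixes_perp (m : subalg n) :
  two_sided_ideal m -> forall gamma, gamma \in perp m ->
  [set dlact g (dract h gamma) | g in subalg_group m,
                                 h in subalg_group m] = [set gamma].
Proof.
move=> idm gamma /perpP gm0.
have fix_gamma g h : g \in subalg_group m -> h \in subalg_group m ->
    dlact g (dract h gamma) = gamma.
  rewrite -groupV inE => mg; rewrite -groupV inE => mh; apply/lfunP=> X.
  rewrite dactE /ract linearD /= [X in _ + X]gm0 ?addr0.
    by rewrite /lact linearD /= [X in _ + X]gm0 ?addr0 //; case: (idm X _ mg).
  by case: (idm (lact g^-1%g X) _ mh).
apply/setP=> delta; rewrite inE; apply/imset2P/eqP=> [[g h mg mh ->]| ->].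
  exact: fix_gamma.
by exists 1%g 1%g; rewrite ?group1 ?fix_gamma ?group1.
Qed.

(** If gamma is fixed by 1 + Y on one side, with Y in m, then gamma vanishes on
    X Y or Y X for every X in n; as gamma varies, the product must lie in m. *)
Lemma fixes_perp_ideal (m : subalg n) :
  (forall gamma, gamma \in perp m ->
    [set dlact g (dract h gamma) | g in subalg_group m,
                                   h in subalg_group m] = [set gamma]) ->
  two_sided_ideal m.
Proof.
move=> fix_perp.
have fixE g h gamma X : g \in subalg_group m -> h \in subalg_group m ->
    gamma \in perp m ->
    (gamma : 'Hom(n, F^o)) (ract h (lact g X)) = (gamma : 'Hom(n, F^o)) X.
  move=> mg mh /fix_perp fix_gamma.
  have: dlact g^-1%g (dract h^-1%g gamma) \in [set gamma].
    by rewrite -fix_gamma; apply/imset2P; exists g^-1%g h^-1%g; rewrite ?groupV.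
  by move/set1P=> {2}<-; rewrite dactE !invgK.
move=> X Y mY; have mg : OnePlus Y \in subalg_group m by rewrite inE.
split; apply: perp_separates => gamma gm.
  have := fixE 1%g _ gamma X (group1 _) mg gm.
  by rewrite lact1 /ract linearD /= => /(canRL (addKr _)) ->; rewrite addNr.
have := fixE _ 1%g gamma X mg (group1 _) gm.
by rewrite ract1 /lact linearD /= => /(canRL (addKr _)) ->; rewrite addNr.
Qed.

Lemma ideal_perp_stable (m : subalg n) :
  two_sided_ideal m -> forall g h gamma,
  gamma \in perp m -> dlact g (dract h gamma) \in perp m.
Proof.
move=> /two_sided_idealE stab g h gamma /perpP gm0; apply/perpP=> X mX.
by rewrite dactE gm0 ?stab.
Qed.

Lemma perp_stable_supernormal (m : subalg n) :
  (forall g h gamma, gamma \in perp m -> dlact g (dract h gamma) \in perp m) ->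
  supernormal (subalg_group_group m).
Proof.
move=> stab; apply/supernormal_superclass=> g; apply: superclass_stable.
move=> x y X mX; apply: perp_separates => gamma /(stab x^-1%g y^-1%g)/perpP.
by move/(_ X mX); rewrite dactE !invgK.
Qed.

End Supernormal.

Theorem proposition3p1 (F : finFieldType) (n : nilAlgType F) (m : subalg n) :
  [<-> supernormal (subalg_group_group m);
       (subalg_group m <| [set: algGroup n])%g /\
         (forall (g : algGroup n) (X : n), X \in m -> lact g X \in m);
       two_sided_ideal m;
       forall gamma : dual n, gamma \in perp m ->
         [set dlact g (dract h gamma) | g in subalg_group m,
                                        h in subalg_group m] = [set gamma];
       forall (g h : algGroup n) (gamma : dual n),
         gamma \in perp m -> dlact g (dract h gamma) \in perp m].
Proof.
tfae.
- exact: supernormal_normal_stable.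
- by case; apply: normal_stable_ideal.
- exact: ideal_fixes_perp.
- by move/fixes_perp_ideal; apply: ideal_perp_stable.
- exact: perp_stable_supernormal.
Qed.
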